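(* Consider the single-item setting ($m=1$) in which the players' valuations are arbitrary. The Sequential Mechanism is $\alpha$-approximate with respect to social cost for each of the following cost functions: (1) Set Cover cost, with $\alpha=d$, where $d$ is the maximum cardinality of a set in $\mathcal{F}$; (2) Vertex Cover cost in a graph of maximum degree $k$, with $\alpha=k$; (3) Matching cost in a bipartite graph of maximum degree $k$, with $\alpha=k$; (4) Matching cost in a general graph of maximum degree $k$, with $\alpha=(5k+3)/4$.
   Context: Single item: an allocation is a set $T$ of served players with cost $c(T)$; each player $i$ has value $v_i\ge0$; social cost $\pi(T)=c(T)+\sum_{i\notin T}v_i$; $\alpha$-approximate means the output $T$ satisfies $\pi(T)\le\alpha\min_{T'}\pi(T')$ for all truthfully reported values. Sequential Mechanism (single item): process players in a fixed order; with $T$ the set served so far, player $i$ is served (added to $T$) iff her value strictly exceeds the price $c(T\cup\{i\})-c(T)$, which she then pays. Cost functions: (1) Set Cover: universe $U$ and family $\mathcal{F}\subseteq 2^U$ whose union is $U$; players are the elements of $U$; $c(S)$ is the minimum number of sets of $\mathcal{F}$ whose union contains $S$. (2) Vertex Cover: undirected unweighted graph $G=(V,E)$; players are the edges; $c(S)$ is the minimum size of a vertex set covering all edges in $S$. (3),(4) Matching: undirected unweighted graph $G=(V,E)$; players are the edges; $c(S)$ is the maximum cardinality of a matching contained in $S$. *)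

(* Defs.v *)
From HB Require Import structures.
From mathcomp Require Import all_boot all_order all_algebra.
Set Implicit Arguments. Unset Strict Implicit. Unset Printing Implicit Defensive.
Import Order.TTheory GRing.Theory Num.Theory.
Local Open Scope ring_scope.

Section Mech.
Variables (R : realFieldType) (P : finType).

Definition seqmech (c : {set P} -> nat) (v : P -> R) (s : seq P) : {set P} :=
  foldl (fun T i => if (c (i |: T))%:R - (c T)%:R < v i then i |: T else T)
        set0 s.

Definition social_cost (c : {set P} -> nat) (v : P -> R) (N : {set P})
    (T : {set P}) : R :=
  (c T)%:R + \sum_(i in N :\: T) v i.

Definition seqmech_approx (c : {set P} -> nat) (N : {set P}) (alpha : R) :=
  forall (s : seq P) (v : P -> R),
    perm_eq s (enum N) ->
    (forall i, i \in N -> 0 <= v i) ->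
    forall T' : {set P}, T' \subset N ->
      social_cost c v N (seqmech c v s) <= alpha * social_cost c v N T'.
End Mech.

(* c(S) = minimum number of sets of F whose union contains S
   (F itself is always a candidate when F covers the universe). *)
Definition setcover_cost (U : finType) (F : {set {set U}}) (S : {set U}) : nat :=
  \big[minn/#|F|]_(G in powerset F | S \subset cover G) #|G|.

Definition max_set_size (U : finType) (F : {set {set U}}) : nat :=
  \max_(A in F) #|A|.

Definition simple_graph (V : finType) (E : {set {set V}}) : bool :=
  [forall e in E, #|e| == 2].

Definition degree (V : finType) (E : {set {set V}}) (x : V) : nat :=
  #|[set e in E | x \in e]|.

Definition max_degree (V : finType) (E : {set {set V}}) : nat :=
  \max_(x : V) degree E x.

Definition bipartite (V : finType) (E : {set {set V}}) : Prop :=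
  exists X : {set V}, forall e, e \in E -> #|e :&: X| = 1.

Definition vertexcover_cost (V : finType) (S : {set {set V}}) : nat :=
  \big[minn/#|V|]_(C : {set V} | [forall e in S, e :&: C != set0]) #|C|.

Definition is_matching (V : finType) (M : {set {set V}}) : bool :=
  [forall e1 in M, forall e2 in M, (e1 != e2) ==> [disjoint e1 & e2]].

Definition matching_cost (V : finType) (S : {set {set V}}) : nat :=
  \max_(M in powerset S | is_matching M) #|M|.

(* Main.v *)
(* All four costs have marginals 0 or 1, so the mechanism pays at most min(v_i, 1)
   for each player i.  Against an allocation T', the players outside T' contribute
   at most their values and those of T' at most 1 each, so it is enough to show
   |S| <= alpha * c(S) for every set S of players.

   For covers this is counting.  For matchings, put a = k (bipartite) or a = k+1
   (general); we get |E| <= a * nu(E) by induction on nu.  If some vertex lies in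
   every maximum matching, deleting it removes at most k edges and decreases nu by
   one.  Otherwise, by Gallai's lemma, "no maximum matching misses both u and v"
   is an equivalence relation; edges stay inside classes, and a maximum matching
   misses at most one vertex of each class, so a class with m matching edges has
   at most 2m+1 vertices, hence at most a * m edges.  Finally k+1 <= (5k+3)/4 as
   soon as k >= 1. *)
Require Import Defs.
From HB Require Import structures.
From mathcomp Require Import all_boot all_order all_algebra.
From mathcomp Require Import zify lra.
Import Order.TTheory GRing.Theory Num.Theory.
Local Open Scope ring_scope.

(** * Social cost of the mechanism under marginal costs 0 or 1 *)

Section SeqMech.
Variables (R : realFieldType) (P : finType) (c : {set P} -> nat) (v : P -> R).

Lemma seqmech_rcons (s : seq P) (i : P) :
  seqmech c v (rcons s i) =
  if (c (i |: seqmech c v s))%:R - (c (seqmech c v s))%:R < v i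
  then i |: seqmech c v s else seqmech c v s.
Proof. by rewrite /seqmech foldl_rcons. Qed.

Lemma seqmech_sub (s : seq P) : {subset seqmech c v s <= s}.
Proof.
elim/last_ind: s => [|s i IHs] x; first by rewrite inE.
rewrite seqmech_rcons mem_rcons in_cons; case: ifP => _; last first.
  by move=> /IHs ->; rewrite orbT.
by rewrite in_setU1 => /orP[->//|/IHs ->]; rewrite orbT.
Qed.

(** Each player raises the left side by one term only: the price if served, which is below [v i] and
    at most 1, or [v i] if rejected, which is then at most the price. Either way the increase is at
    most [Num.min (v i) 1]. *)
Lemma seqmech_cost_le (N : {set P}) (s : seq P) :
    c set0 = 0%N ->
    (forall (i : P) (T : {set P}), i \in N -> T \subset N ->
       (c T <= c (i |: T) <= (c T).+1)%N) ->
    uniq s -> {subset s <= N} -> (forall i, i \in N -> 0 <= v i) ->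
  (c (seqmech c v s))%:R + \sum_(i <- s | i \notin seqmech c v s) v i
    <= \sum_(i <- s) Num.min (v i) 1.
Proof.
move=> c0 c1; elim/last_ind: s => [|s i IHs] Us sN v0.
  by rewrite !big_nil /seqmech /= c0 addr0.
have [Nis Us'] : i \notin s /\ uniq s by apply/andP; rewrite -rcons_uniq.
have sN' : {subset s <= N} by move=> x xs; apply: sN; rewrite mem_rcons inE xs orbT.
have iN : i \in N by apply: sN; rewrite mem_rcons inE eqxx.
have {}IHs := IHs Us' sN' v0.
have TN : seqmech c v s \subset N by apply/subsetP => x /seqmech_sub /sN'.
have NiT : i \notin seqmech c v s by apply: contra Nis => /seqmech_sub.
have /andP[c_ge c_le] := c1 i _ iN TN.
have vi0 := v0 i iN.
rewrite seqmech_rcons !big_rcons /=.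
move: c_ge c_le; rewrite -(ler_nat R) -(ler_nat R (c (i |: _))) mulrS => c_ge c_le.
case: ifPn => [acc|]; last rewrite -leNgt => rej.
  rewrite setU11 /=.
  (* As [i] does not occur in [s], serving it leaves the earlier rejected players unchanged. *)
  have -> : \sum_(j <- s | j \notin i |: seqmech c v s) v j =
            \sum_(j <- s | j \notin seqmech c v s) v j.
    rewrite big_seq_cond [RHS]big_seq_cond; apply: eq_bigl => j.
    rewrite in_setU1; case: eqP => // ->; by rewrite (negPf Nis).
  have : (c (i |: seqmech c v s))%:R - (c (seqmech c v s))%:R <= Num.min (v i) 1.
    by rewrite le_min (ltW acc) /=; lra.
  lra.
rewrite NiT.
have : v i <= Num.min (v i) 1 by rewrite le_min lexx /=; lra.
lra.
Qed.

End SeqMech.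

Lemma seqmech_approx_card_le (R : realFieldType) (P : finType)
    (c : {set P} -> nat) (N : {set P}) (alpha : R) :
    c set0 = 0%N ->
    (forall (i : P) (T : {set P}), i \in N -> T \subset N ->
       (c T <= c (i |: T) <= (c T).+1)%N) ->
    (forall S : {set P}, S \subset N -> #|S|%:R <= alpha * (c S)%:R) ->
  seqmech_approx c N alpha.
Proof.
move=> c0 c1 calpha s v ps v0 T' T'N.
have Us : uniq s by rewrite (perm_uniq ps) enum_uniq.
have sN : s =i N by move=> x; rewrite (perm_mem ps) mem_enum.
have sumN (F : P -> R) (Q : pred P) :
    \sum_(i <- s | Q i) F i = \sum_(i in N | Q i) F i.
  by rewrite (perm_big _ ps) /= big_enum_cond.
have := seqmech_cost_le _ _ c v N s c0 c1 Us (fun x => etrans (esym (sN x))) v0.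
rewrite !sumN => mech_le.
have -> : social_cost c v N (seqmech c v s) =
   (c (seqmech c v s))%:R + \sum_(i in N | i \notin seqmech c v s) v i.
  by congr (_ + _); apply: eq_bigl => i; rewrite inE andbC.
apply: le_trans mech_le _; rewrite (eq_bigl (mem N)) => [|i]; last by rewrite andbT.
rewrite (big_setID T') /= (setIidPr T'N) /social_cost mulrDr.
apply: lerD.
  apply: le_trans (calpha _ T'N); rewrite -sum1_card natr_sum.
  by apply: ler_sum => i _; rewrite ge_min lexx orbT.
rewrite mulr_sumr; apply: ler_sum => i /setDP[iN _].
(* The hypothesis for the singleton of [i] reads 1 <= alpha * c({i}) with c({i}) in {0, 1}, and 0 is
   absurd. Hence min(v_i, 1) <= v_i <= alpha * v_i. *)
have alpha1 : 1 <= alpha.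
  have := calpha [set i]; rewrite sub1set cards1 => /(_ iN).
  have := c1 i set0 iN (sub0set _); rewrite setU0 c0 => /andP[_].
  by case: (c [set i]) => [|[|//]] _; rewrite ?mulr0 ?mulr1 // ler10.
by rewrite ge_min ler_peMl // v0.
Qed.

Local Open Scope nat_scope.

(** * Set cover: marginals and counting *)

Section SetCover.
Variables (U : finType) (F : {set {set U}}).
Hypothesis coverF : cover F = [set: U].

Lemma setcover_cost_le (S : {set U}) (G : {set {set U}}) :
  G \subset F -> S \subset cover G -> setcover_cost F S <= #|G|.
Proof.
move=> GF SG; rewrite /setcover_cost -minEnat.
by apply: (@bigmin_le_cond _ nat _ #|F|); rewrite powersetE GF.
Qed.

(** The default [#|F|] of the minimum is harmless: [F] is itself an admissible cover, and no
    subfamily is larger. *)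
Lemma setcover_cost_attained (S : {set U}) :
  exists G : {set {set U}},
    [/\ G \subset F, S \subset cover G & setcover_cost F S = #|G|].
Proof.
rewrite /setcover_cost -minEnat.
case: (@eq_bigmin _ nat _ #|F| F
  (fun G : {set {set U}} => (G \in powerset F) && (S \subset cover G))
  (fun G => #|G|)) => [|G|G].
- by rewrite powersetE subxx coverF subsetT.
- by rewrite powersetE => /andP[GF _]; apply: subset_leq_card.
- by rewrite unfold_in powersetE => /andP[GF SG] ->; exists G.
Qed.

Lemma setcover_cost0 : setcover_cost F set0 = 0.
Proof.
by apply/eqP; rewrite -leqn0 -(@cards0 {set U}) setcover_cost_le ?sub0set.
Qed.

Lemma setcover_cost_marginal (i : U) (T : {set U}) :
  setcover_cost F T <= setcover_cost F (i |: T) <= (setcover_cost F T).+1.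
Proof.
apply/andP; split.
  have [G [GF TG ->]] := setcover_cost_attained (i |: T).
  by rewrite setcover_cost_le // (subset_trans _ TG) // subsetUr.
have [G [GF TG ->]] := setcover_cost_attained T.
have /bigcupP[A AF iA] : i \in cover F by rewrite coverF.
apply: leq_trans (setcover_cost_le _ (A |: G) _ _) _.
- by rewrite subUset sub1set AF.
- by rewrite /cover bigcup_setU big_set1 setUSS // sub1set.
- by rewrite cardsU1; case: (_ \notin _); lia.
Qed.

Lemma card_le_setcover_cost (S : {set U}) :
  #|S| <= max_set_size F * setcover_cost F S.
Proof.
have [G [GF SG ->]] := setcover_cost_attained S.
apply: leq_trans (subset_leq_card SG) _.
apply: leq_trans (leq_card_cover G) _.
rewrite mulnC -sum_nat_const; apply: leq_sum => A AG.
by apply: (@bigop.bigmax_sup _ A); rewrite ?(subsetP GF).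
Qed.
End SetCover.

(** * Simple graphs and vertex cover *)

Lemma simple_graph_card (V : finType) (E : {set {set V}}) (e : {set V}) :
  simple_graph E -> e \in E -> #|e| = 2.
Proof. by move=> /forall_inP sE /sE /eqP. Qed.

Lemma simple_graph_sub (V : finType) (E S : {set {set V}}) :
  S \subset E -> simple_graph E -> simple_graph S.
Proof.
move=> /subsetP SE /forall_inP sE; apply/forall_inP => e /SE; exact: sE.
Qed.

Lemma degree_le_max (V : finType) (E S : {set {set V}}) (x : V) :
  S \subset E -> degree S x <= max_degree E.
Proof.
move=> SE; apply: leq_trans (leq_bigmax x); apply: subset_leq_card.
by apply/subsetP => e; rewrite !inE => /andP[/(subsetP SE) -> ->].
Qed.

Section VertexCover.
Variables (V : finType).
Implicit Types (S : {set {set V}}) (C : {set V}).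

Lemma vertexcover_cost_le S C :
  {in S, forall e, e :&: C != set0} -> vertexcover_cost S <= #|C|.
Proof.
move=> SC; rewrite /vertexcover_cost -minEnat.
by apply: (@bigmin_le_cond _ nat _ #|V|); apply/forall_inP.
Qed.

(** Nonempty edges make the whole vertex set a cover, so the default [#|V|] is never below the true
    minimum. *)
Lemma vertexcover_cost_attained S :
    {in S, forall e, e != set0} ->
  exists2 C, {in S, forall e, e :&: C != set0} & vertexcover_cost S = #|C|.
Proof.
move=> S0; rewrite /vertexcover_cost -minEnat.
case: (@eq_bigmin _ nat _ #|V| [set: V]
  (fun C : {set V} => [forall e in S, e :&: C != set0])
  (fun C => #|C|)) => [|C _|C].
- by apply/forall_inP => e /S0; rewrite setIT.
- exact: max_card.
- by rewrite unfold_in => /forall_inP SC ->; exists C.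
Qed.

Lemma vertexcover_cost0 : vertexcover_cost (set0 : {set {set V}}) = 0.
Proof.
apply/eqP; rewrite -leqn0 -(@cards0 V).
by apply: vertexcover_cost_le => e; rewrite inE.
Qed.

Lemma vertexcover_cost_marginal (e : {set V}) S :
    e != set0 -> {in S, forall e, e != set0} ->
  vertexcover_cost S <= vertexcover_cost (e |: S) <= (vertexcover_cost S).+1.
Proof.
move=> e0 S0; apply/andP; split.
  have [f /setU1P[->//|/S0//]|C SC ->] := vertexcover_cost_attained (e |: S).
  by apply: vertexcover_cost_le => f fS; rewrite SC // setU1r.
have [C SC ->] := vertexcover_cost_attained S S0.
have /set0Pn[x xe] := e0.
apply: leq_trans (vertexcover_cost_le _ (x |: C) _) _.
  move=> f /setU1P[->|/SC]; first by apply/set0Pn; exists x; rewrite !inE xe eqxx.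
  by move=> /set0Pn[y /setIP[yf yC]]; apply/set0Pn; exists y; rewrite !inE yf yC orbT.
by rewrite cardsU1; case: (_ \notin _); lia.
Qed.

(** Double counting of the pairs (x, e) with x in both C and e: every edge occurs at least once. It
    serves again for the two sides of a bipartite graph. *)
Lemma card_le_sum_degree S C :
  {in S, forall e, e :&: C != set0} -> #|S| <= \sum_(x in C) degree S x.
Proof.
move=> SC; under eq_bigr do rewrite /degree -sum1_card.
rewrite (exchange_big_dep (mem S)) /=; last by move=> x e _; rewrite inE => /andP[].
rewrite -sum1_card; apply: leq_sum => e eS.
have /set0Pn[x /setIP[xe xC]] := SC e eS.
by rewrite (bigD1 x) //= inE xC eS xe.
Qed.

Lemma card_le_vertexcover_cost S (k : nat) :
    {in S, forall e, e != set0} -> (forall x, degree S x <= k) ->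
  #|S| <= k * vertexcover_cost S.
Proof.
move=> /vertexcover_cost_attained[C SC ->] degk.
apply: leq_trans (card_le_sum_degree _ _ SC) _.
by rewrite mulnC -sum_nat_const; apply: leq_sum.
Qed.
End VertexCover.

(** * Matchings and the marginals of the matching cost *)

Section Matching.
Variable V : finType.
Implicit Types (E S M N : {set {set V}}) (e f : {set V}) (u v w x y : V).

Lemma is_matchingP M :
  reflect {in M &, forall e f, e != f -> [disjoint e & f]} (is_matching M).
Proof.
apply: (iffP forall_inP) => [mM e f eM fM ef | mM e eM].
  by have /forall_inP/(_ f fM)/implyP/(_ ef) := mM e eM.
by apply/forall_inP => f fM; apply/implyP; apply: mM.
Qed.

Lemma is_matching_sub M N : M \subset N -> is_matching N -> is_matching M.
Proof.
move=> /subsetP MN /is_matchingP mN; apply/is_matchingP => e f /MN eN /MN fN.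
exact: mN.
Qed.

Lemma matching_mem_eq M e f x :
  is_matching M -> e \in M -> f \in M -> x \in e -> x \in f -> e = f.
Proof.
move=> /is_matchingP mM eM fM xe xf; apply/eqP/negPn/negP => ef.
by move/pred0P/(_ x): (mM e f eM fM ef); rewrite /= xe xf.
Qed.

Lemma is_matchingU1 e M :
  is_matching M -> {in M, forall f, [disjoint e & f]} -> is_matching (e |: M).
Proof.
move=> /is_matchingP mM eM; apply/is_matchingP => f g.
move=> /setU1P[->|fM] /setU1P[->|gM]; rewrite ?eqxx // => fg.
- exact: eM.
- by rewrite disjoint_sym eM.
- exact: mM.
Qed.

Lemma card_le_matching_cost M S :
  M \subset S -> is_matching M -> #|M| <= matching_cost S.
Proof.
by move=> MS mM; apply: (@bigop.bigmax_sup _ M); rewrite // powersetE MS.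
Qed.

Lemma matching_cost_attained S :
  exists M, [/\ M \subset S, is_matching M & matching_cost S = #|M|].
Proof.
pose P M := (M \in powerset S) && is_matching M.
have P0 : P set0.
  by rewrite /P powersetE sub0set; apply/is_matchingP => e f; rewrite inE.
rewrite /matching_cost (@bigop.bigmax_eq_arg _ set0 P _ P0).
by case: arg_maxnP => // M /andP[]; rewrite powersetE => MS mM _; exists M.
Qed.

Lemma matching_cost0 : matching_cost (set0 : {set {set V}}) = 0.
Proof.
have [M [+ _ ->]] := matching_cost_attained set0.
by rewrite subset0 => /eqP ->; rewrite cards0.
Qed.

(** For the upper bound, deleting [e] from an optimal matching of [e |: S] leaves a matching of
    [S]. *)
Lemma matching_cost_marginal e S :
  matching_cost S <= matching_cost (e |: S) <= (matching_cost S).+1.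
Proof.
apply/andP; split.
  have [M [MS mM ->]] := matching_cost_attained S.
  by rewrite card_le_matching_cost // (subset_trans MS) // subsetUr.
have [M [MS mM ->]] := matching_cost_attained (e |: S).
have : #|M :\ e| <= matching_cost S.
  by rewrite card_le_matching_cost ?subDset ?(is_matching_sub _ _ (subsetDl M _)).
by rewrite (cardsD1 e M); case: (e \in M) => H; [exact: H | exact: leqW H].
Qed.

(** * Maximum matchings and Gallai's lemma *)

Definition maximum_matching E M :=
  [&& M \subset E, is_matching M & #|M| == matching_cost E].

Lemma maximum_matching_exists E : exists M, maximum_matching E M.
Proof.
have [M [ME mM cM]] := matching_cost_attained E.
by exists M; rewrite /maximum_matching ME mM cM eqxx.
Qed.

Lemma card_cover_matching E M :
  simple_graph E -> M \subset E -> is_matching M -> #|cover M| = 2 * #|M|.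
Proof.
move=> sE ME /is_matchingP mM; have tM : trivIset M by apply/trivIsetP.
rewrite -(eqP tM) mulnC -sum_nat_const; apply: eq_bigr => e eM.
by apply: simple_graph_card sE _; apply: (subsetP ME).
Qed.

Lemma maximum_matching_meets E M e :
    simple_graph E -> maximum_matching E M -> e \in E ->
  exists2 x, x \in e & x \in cover M.
Proof.
move=> sE /and3P[ME mM /eqP cM] eE.
have [/exists_inP//|/exists_inPn NeM] := boolP [exists x in e, x \in cover M]; exfalso.
have eNM : e \notin M.
  have /card_gt0P[x xe] : 0 < #|e| by rewrite (simple_graph_card _ _ _ sE eE).
  by apply: contra (NeM x xe) => eM; apply/bigcupP; exists e.
have dis : {in M, forall f, [disjoint e & f]}.
  move=> f fM; apply/pred0P => x /=; apply/negP => /andP[xe xf].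
  by have /bigcupP := NeM x xe; apply; exists f.
have := card_le_matching_cost (e |: M) E; rewrite subUset sub1set eE ME.
by move=> /(_ isT (is_matchingU1 _ _ mM dis)); rewrite cardsU1 eNM -cM; lia.
Qed.

(** The negation of the relation in Gallai's lemma. The conjunct [u != v] makes that relation
    reflexive even at vertices that some maximum matching misses. *)
Definition jointly_missed E u v :=
  (u != v) && [exists M, [&& maximum_matching E M, u \notin cover M & v \notin cover M]].

Lemma jointly_missedC E u v : jointly_missed E u v = jointly_missed E v u.
Proof.
rewrite /jointly_missed eq_sym; congr (_ && _).
by apply: eq_existsb => M; congr (_ && _); rewrite andbC.
Qed.

Lemma edge_not_jointly_missed E e u v :
  simple_graph E -> e \in E -> u \in e -> v \in e -> ~~ jointly_missed E u v.
Proof.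
move=> sE eE ue ve; apply/negP => /andP[uv /existsP[M /and3P[maxM uM vM]]].
have /eqP/cards2P[a [b [ab eab]]] := simple_graph_card _ _ _ sE eE.
have [x xe xM] := maximum_matching_meets _ _ _ sE maxM eE.
have : x \in [set u; v].
  move: ue ve xe uv; rewrite eab !inE.
  by move=> /orP[]/eqP-> /orP[]/eqP-> /orP[]/eqP->; rewrite ?eqxx ?orbT.
by rewrite !inE => /orP[/eqP xu|/eqP xv]; [rewrite -xu xM in uM|rewrite -xv xM in vM].
Qed.

(* If [M] misses [u] and [v], a maximum matching [N] missing [w] and sharing as
   many edges as possible with [M] could be improved by swapping one edge. *)
Lemma jointly_missed_split E u v w :
    simple_graph E ->
    (exists2 N, maximum_matching E N & w \notin cover N) ->
  jointly_missed E u v -> jointly_missed E u w || jointly_missed E w v.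
Proof.
move=> sE [N0 maxN0 wN0] /andP[uv /existsP[M /and3P[maxM uM vM]]].
apply/negPn/negP; rewrite negb_or => /andP[Nuw Nwv].
have uw : u != w.
  by apply: contraNneq Nwv => <-; rewrite /jointly_missed uv; apply/existsP; exists M; apply/and3P.
have wv : w != v.
  by apply: contraNneq Nuw => ->; rewrite /jointly_missed uv; apply/existsP; exists M; apply/and3P.
pose Q N := maximum_matching E N && (w \notin cover N).
have Q0 : Q N0 by rewrite /Q maxN0.
have [N /andP[maxN wN] bestN] := arg_maxnP (fun N => #|M :&: N|) Q0.
have uN : u \in cover N.
  apply: contraNT Nuw => uN; rewrite /jointly_missed uw; apply/existsP.
  by exists N; apply/and3P.
have vN : v \in cover N.
  apply: contraNT Nwv => vN; rewrite /jointly_missed wv; apply/existsP.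
  by exists N; apply/and3P.
have [ME mM /eqP cM] := and3P maxM; have [NE mN /eqP cN] := and3P maxN.
(* Both matchings cover equally many vertices, and [N] covers [u] and [v], which [M] misses. So [M]
   covers at least two vertices missed by [N], and one of them differs from [w]. *)
have [x xMN xw] : exists2 x, x \in cover M :\: cover N & x != w.
  have cMN : #|cover M| = #|cover N|.
    by rewrite (card_cover_matching E) // (card_cover_matching E N) // cM cN.
  have uvNM : [set u; v] \subset cover N :\: cover M.
    by apply/subsetP => y /set2P[]->; rewrite inE ?uM ?vM.
  have := subset_leq_card uvNM; rewrite cards2 uv.
  have := cardsID (cover N) (cover M); have := cardsID (cover M) (cover N).
  rewrite (setIC (cover M)) => c1 c2 c3.
  have /card_gt0P[x] : 0 < #|(cover M :\: cover N) :\ w|.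
    have := cardsD1 w (cover M :\: cover N); move: c1 c2 c3 cMN; clear.
    by case: (_ \in _); lia.
  by rewrite in_setD1 => /andP[xw xMN]; exists x.
have /setDP[/bigcupP[e eM xe] xN] := xMN.
have eE := subsetP ME e eM.
(* The other end [y] of [e] is covered by [N], through an edge [f] outside [M]. Replacing [f] by [e]
   in [N] keeps it maximum and still missing [w]. *)
have [y ye yN] := maximum_matching_meets _ _ _ sE maxN eE.
have xy : x != y by apply: contraNneq xN => ->.
have exy : e = [set x; y].
  apply/esym/eqP; rewrite eqEcard cards2 xy (simple_graph_card _ _ _ sE eE) leqnn andbT.
  by apply/subsetP => z /set2P[]->.
have /bigcupP[f fN yf] := yN.
have eN : e \notin N by apply: contraNN xN => eN; apply/bigcupP; exists e.
have fM : f \notin M.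
  by apply: contraNN eN => fM; rewrite (matching_mem_eq _ _ _ _ mM eM fM ye yf).
have mN' : is_matching (e |: N :\ f).
  apply: is_matchingU1; first exact: is_matching_sub (subsetDl _ _) mN.
  move=> g /setD1P[gf gN]; apply/pred0P => z /=; apply/negP => /andP[].
  rewrite exy => /set2P[->|->] zg.
    by case/negP: xN; apply/bigcupP; exists g.
  by rewrite (matching_mem_eq _ _ _ _ mN gN fN zg yf) eqxx in gf.
have cN' : #|e |: N :\ f| = #|N|.
  by rewrite cardsU1 !inE (negPf eN) andbF (cardsD1 f N) fN.
have maxN' : maximum_matching E (e |: N :\ f).
  rewrite /maximum_matching mN' cN' cN eqxx !andbT subUset sub1set eE.
  exact: subset_trans (subsetDl _ _) NE.
have wN' : w \notin cover (e |: N :\ f).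
  apply/bigcupP => -[g /setU1P[->|/setD1P[_ gN]] wg]; last first.
    by case/negP: wN; apply/bigcupP; exists g.
  move: wg; rewrite exy => /set2P[wx|wy]; first by rewrite wx eqxx in xw.
  by rewrite wy yN in wN.
(* The swapped matching shares one more edge with [M], namely [e], and loses none, as [f] is not in
   [M]. *)
have := bestN (e |: N :\ f); rewrite /Q maxN' wN' => /(_ isT).
have : e |: (M :&: N) \subset M :&: (e |: N :\ f).
  apply/subsetP => g; rewrite !inE => /orP[/eqP->|/andP[gM gN]].
    by rewrite eM eqxx.
  by rewrite gM gN andbT orbC; case: eqP => // gf; rewrite -gf gM in fM.
move=> /subset_leq_card; rewrite cardsU1 inE (negPf eN) andbF add1n => lt.
by move=> /(leq_trans lt); rewrite ltnn.
Qed.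

(** * Gallai classes and the induction on the matching number *)

Definition induced E (C : {set V}) := [set e in E | e \subset C].

Definition missed_class E u := [set v | ~~ jointly_missed E u v].

Lemma missed_class_refl E u : u \in missed_class E u.
Proof. by rewrite inE /jointly_missed eqxx. Qed.

Section Classes.
Variable E : {set {set V}}.
Hypotheses (sE : simple_graph E).
Hypothesis missable : forall w, exists2 N, maximum_matching E N & w \notin cover N.

(** Transitivity is the contrapositive of [jointly_missed_split], whose middle vertex must be missed
    by some maximum matching; [missable] provides this. *)
Lemma missed_class_eq u v : v \in missed_class E u -> missed_class E u = missed_class E v.
Proof.
have sub a b : b \in missed_class E a -> missed_class E b \subset missed_class E a.
  rewrite inE => ab; apply/subsetP => x; rewrite !inE => bx.
  apply/negP => /(jointly_missed_split _ _ _ _ sE (missable b)).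
  by rewrite (negPf ab) (negPf bx).
move=> uv; apply/eqP; rewrite eqEsubset !sub // inE jointly_missedC.
by rewrite inE in uv.
Qed.

Lemma edge_sub_missed_class e u :
  e \in E -> u \in e -> e \subset missed_class E u.
Proof.
move=> eE ue; apply/subsetP => v ve; rewrite inE.
exact: edge_not_jointly_missed sE eE ue ve.
Qed.

(** Each edge lies in exactly one class, that of either endpoint. The subset [S] is free because the
    identity is applied both to [E] and to a maximum matching. *)
Lemma card_sum_missed_class S :
    S \subset E ->
  #|S| = \sum_(C in [set missed_class E u | u : V]) #|induced S C|.
Proof.
move=> SE; under eq_bigr do rewrite -sum1_card.
rewrite (exchange_big_dep (mem S)) /=; last by move=> C e _; rewrite inE => /andP[].
rewrite -sum1_card; apply: eq_bigr => e eS.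
have eE := subsetP SE e eS.
have /card_gt0P[x xe] : 0 < #|e| by rewrite (simple_graph_card _ _ _ sE eE).
rewrite (big_pred1 (missed_class E x)) // => C; rewrite inE eS /=.
apply/andP/eqP => [[/imsetP[u _ ->] /subsetP/(_ x xe)]|->].
  exact: missed_class_eq.
by rewrite imset_f // edge_sub_missed_class.
Qed.

(** The covered vertices of the class are ends of matching edges lying inside it, two per edge. Two
    uncovered ones would be jointly missed by [M], so there is at most one. *)
Lemma card_missed_class M u :
    maximum_matching E M ->
  #|missed_class E u| <= 2 * #|induced M (missed_class E u)| + 1.
Proof.
set C := missed_class E u => maxM; have [ME mM _] := and3P maxM.
have MCM : induced M C \subset M by apply/subsetP => e; rewrite inE => /andP[].
rewrite -(card_cover_matching E) ?(subset_trans MCM) //; last exact: is_matching_sub MCM mM.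
rewrite -(cardsID (cover M) C); apply: leq_add.
  apply: subset_leq_card; apply/subsetP => x /setIP[xC /bigcupP[e eM xe]].
  apply/bigcupP; exists e => //; rewrite inE eM /C (missed_class_eq u x xC).
  by rewrite edge_sub_missed_class ?(subsetP ME).
apply/card_le1_eqP => x y /setDP[xC xM] /setDP[yC yM].
apply/eqP/negPn/negP => xy.
move: yC; rewrite /C (missed_class_eq u x xC) inE /jointly_missed eq_sym xy /=.
by case/existsP; exists M; apply/and3P.
Qed.
End Classes.

(** The bound on induced edge sets is kept as a hypothesis so that general and bipartite graphs
    share one induction; it passes to subsets of [E]. *)
Lemma card_le_mul_matching_cost E (a : nat) :
    simple_graph E -> (forall x, degree E x <= a) ->
    (forall (C : {set V}) m, #|C| <= 2 * m + 1 -> #|induced E C| <= a * m) ->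
  #|E| <= a * matching_cost E.
Proof.
have [n] := ubnP (matching_cost E).
elim: n E => // n IHn E /ltnSE nuE sE degE indE.
have [/existsP[v vE]|/existsPn missable] :=
  boolP [exists v, matching_cost [set e in E | v \notin e] < matching_cost E].
  set E' := [set e in E | v \notin e] in vE.
  have E'E : E' \subset E by apply/subsetP => e; rewrite inE => /andP[].
  have cE : #|E| = degree E v + #|E'|.
    rewrite -(cardsID [set e : {set V} | v \in e] E); congr (_ + _);
      by apply: eq_card => e; rewrite !inE // andbC.
  have : #|E'| <= a * matching_cost E'.
    apply: IHn => [|| x | C m /indE].
    - exact: leq_trans vE nuE.
    - exact: simple_graph_sub E'E sE.
    - apply: leq_trans (degE x); apply: subset_leq_card; apply/subsetP => e.
      by rewrite !inE => /andP[/andP[-> _] ->].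
    - apply: leq_trans; apply: subset_leq_card; apply/subsetP => e.
      by rewrite !inE => /andP[/andP[-> _] ->].
  (* At most [a] edges are removed while the matching number drops by at least one. *)
  by have := degE v; nia.
(* Discarding the edges at [w] does not lower the matching number, so an optimal matching of the
   rest is maximum in [E] and misses [w]. *)
have {}missable w : exists2 N, maximum_matching E N & w \notin cover N.
  have [N [NE mN cN]] := matching_cost_attained [set e in E | w \notin e].
  have {}NE e : e \in N -> e \in E /\ w \notin e.
    by move=> /(subsetP NE); rewrite inE => /andP.
  have NE' : N \subset E by apply/subsetP => e /NE[].
  exists N; last by apply/bigcupP => -[e /NE[_ /negP]].
  rewrite /maximum_matching NE' mN eqn_leq card_le_matching_cost //=.
  by rewrite -cN leqNgt missable.
have [M maxM] := maximum_matching_exists E; have [ME mM /eqP <-] := and3P maxM.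
rewrite (card_sum_missed_class E sE missable E) //.
rewrite (card_sum_missed_class E sE missable M) // big_distrr /=.
apply: leq_sum => C /imsetP[u _ ->]; apply: indE.
exact: card_missed_class.
Qed.

(** * Edge counts inside a class *)

Lemma card_induced_general E (C : {set V}) (k m : nat) :
    simple_graph E -> (forall x, degree E x <= k) -> #|C| <= 2 * m + 1 ->
  #|induced E C| <= k.+1 * m.
Proof.
move=> sE degE Cm.
have cardC e : e \in induced E C -> #|e| = 2 /\ e \subset C.
  by rewrite inE => /andP[eE eC]; rewrite (simple_graph_card _ _ _ sE eE).
have deg_le : 2 * #|induced E C| <= k * #|C|.
  have -> : 2 * #|induced E C| = \sum_(e in induced E C) \sum_(x in C | x \in e) 1.
    rewrite mulnC -sum_nat_const; apply: eq_bigr => e /cardC[<- eC].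
    rewrite -sum1_card; apply: eq_bigl => x.
    by apply/idP/andP => [xe|[]//]; rewrite (subsetP eC).
  rewrite (exchange_big_dep (mem C)) /=; last by move=> e x _ /andP[].
  rewrite mulnC -sum_nat_const; apply: leq_sum => x xC.
  apply: leq_trans (degE x); rewrite sum1_card; apply: subset_leq_card.
  apply/subsetP => e; rewrite unfold_in !inE.
  by move=> /and3P[/andP[-> _] _ ->].
have bin_le : #|induced E C| <= 'C(#|C|, 2).
  rewrite -(cards_draws C 2); apply: subset_leq_card; apply/subsetP => e /cardC[e2 eC].
  by rewrite inE eC e2.
have {}bin_le : 2 * #|induced E C| <= #|C| * #|C|.-1.
  by apply: leq_trans (leq_mul (leqnn 2) bin_le) _; rewrite bin2 mul2n halfK leq_subr.
(* If 2m <= k, the binomial bound gives at most m(2m+1) <= (k+1)m edges. If k < 2m, the degree bound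
   gives twice the edges <= k(2m+1) = 2km + k <= 2(k+1)m. *)
have [mk|km] := leqP (2 * m) k; nia.
Qed.

(** Each side of the bipartition within [C] covers all edges inside [C], and since [C] has at most
    2m+1 vertices, one side has at most m. *)
Lemma card_induced_bipartite E (C : {set V}) (k m : nat) :
    simple_graph E -> bipartite E -> (forall x, degree E x <= k) ->
    #|C| <= 2 * m + 1 ->
  #|induced E C| <= k * m.
Proof.
move=> sE [X EX] degE Cm.
have side D : {in induced E C, forall e, e :&: D != set0} -> #|induced E C| <= k * #|D|.
  move=> HD; apply: leq_trans (card_le_sum_degree _ _ _ HD) _.
  rewrite mulnC -sum_nat_const; apply: leq_sum => x xC.
  apply: leq_trans (degE x); apply: subset_leq_card.
  by apply/subsetP => e; rewrite !inE => /andP[/andP[-> _] ->].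
have sideI : #|induced E C| <= k * #|C :&: X|.
  apply: side => e; rewrite inE => /andP[eE eC].
  by rewrite setIA (setIidPl eC) -card_gt0 EX.
have sideD : #|induced E C| <= k * #|C :\: X|.
  apply: side => e; rewrite inE => /andP[eE eC].
  rewrite setIDA (setIidPl eC) -card_gt0; have := cardsID X e.
  by rewrite EX // (simple_graph_card _ _ _ sE eE) => -[]; rewrite add0n => ->.
have [Xm|mX] := leqP #|C :&: X| m.
  by apply: leq_trans sideI _; rewrite leq_mul2l Xm orbT.
apply: leq_trans sideD _; rewrite leq_mul2l; apply/orP; right.
by have := cardsID X C; lia.
Qed.
End Matching.

Local Open Scope ring_scope.

Theorem mainTheorem15 (R : realFieldType) :
  (* (1) Set Cover, alpha = d = max cardinality of a set in F *)
  (forall (U : finType) (F : {set {set U}}),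
      cover F = [set: U] ->
      seqmech_approx (setcover_cost F) [set: U] ((max_set_size F)%:R : R))
  (* (2) Vertex Cover, alpha = k = max degree *)
  /\ (forall (V : finType) (E : {set {set V}}),
      simple_graph E ->
      seqmech_approx (@vertexcover_cost V) E ((max_degree E)%:R : R))
  (* (3) Matching in a bipartite graph, alpha = k *)
  /\ (forall (V : finType) (E : {set {set V}}),
      simple_graph E -> bipartite E ->
      seqmech_approx (@matching_cost V) E ((max_degree E)%:R : R))
  (* (4) Matching in a general graph, alpha = (5k+3)/4 *)
  /\ (forall (V : finType) (E : {set {set V}}),
      simple_graph E ->
      seqmech_approx (@matching_cost V) E
        (((5 * max_degree E + 3)%N)%:R / 4%:R : R)).
Proof.
split=> [U F coverF|].
  apply: seqmech_approx_card_le => [|i T _ _|S _].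
  - exact: setcover_cost0.
  - exact: setcover_cost_marginal.
  - by rewrite -natrM ler_nat card_le_setcover_cost.
split=> [V E sE|].
  have E0 (S : {set {set V}}) : S \subset E -> {in S, forall e, e != set0}.
    by move=> /subsetP SE e /SE eE; rewrite -card_gt0 (simple_graph_card _ _ _ sE eE).
  apply: seqmech_approx_card_le => [|e S eE SE|S SE].
  - exact: vertexcover_cost0.
  - by apply: vertexcover_cost_marginal; [apply: (E0 E) | apply: E0].
  - rewrite -natrM ler_nat; apply: card_le_vertexcover_cost; first exact: E0.
    by move=> x; apply: degree_le_max.
split=> [V E sE bE|V E sE];
    apply: seqmech_approx_card_le => [|e S _ _|S SE].
- exact: matching_cost0.
- exact: matching_cost_marginal.
- have sS := simple_graph_sub _ _ _ SE sE.
  have bS : bipartite S by have [X EX] := bE; exists X => e /(subsetP SE)/EX.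
  have degS x := degree_le_max _ _ _ x SE.
  rewrite -natrM ler_nat; apply: card_le_mul_matching_cost => // C m Cm.
  exact: card_induced_bipartite.
- exact: matching_cost0.
- exact: matching_cost_marginal.
- have sS := simple_graph_sub _ _ _ SE sE.
  have degS x := degree_le_max _ _ _ x SE.
  rewrite mulrAC ler_pdivlMr ?ltr0n // -!natrM ler_nat.
  have cardS : (#|S| <= (max_degree E).+1 * matching_cost S)%N.
    apply: card_le_mul_matching_cost => // [x|C m Cm]; first exact: leqW.
    exact: card_induced_general.
  (* The inequality 4(k+1) <= 5k+3 needs k >= 1, which any edge of [S] provides; the empty [S] is
     trivial. *)
  have [->|[e eS]] := set_0Vmem S; first by rewrite cards0 mul0n.
  have /card_gt0P[x xe] : (0 < #|e|)%N by rewrite (simple_graph_card _ _ _ sS eS).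
  have kgt0 : (0 < max_degree E)%N.
    apply: leq_trans (degS x); apply/card_gt0P; exists e; by rewrite inE eS.
  move: cardS kgt0; nia.
Qed.
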